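(* For the online fractional admission control problem described in the context there is an online fractional algorithm (the weight-augmentation algorithm) whose cost is at most $O(\log(mc))$ times the cost of an optimal fractional solution, for arbitrary positive request costs. If all request costs equal $1$, the algorithm's cost is at most $O(\log c)$ times the cost of an optimal fractional solution.
   Context: Instance: a directed graph $G=(V,E)$ with $|E|=m$, each edge $e$ having an integer capacity $c_e>0$, and $c=\max_{e\in E} c_e$. Requests $r_1,r_2,\ldots$ arrive online; each request $r_i$ is a simple path in $G$ with a cost $p_i>0$. An online fractional algorithm maintains, for each arrived request $r_i$, a weight $f_i\ge 0$ that can only increase over time (the rejected fraction; $f_i\ge1$ means fully rejected). At any time, $REQ_e$ is the set of arrived requests whose path contains $e$, $REQ=\bigcup_e REQ_e$, $ALIVE_e=\{i\in REQ_e: f_i<1\}$, $n_e=|ALIVE_e|-c_e$; after processing each request the algorithm must satisfy $\sum_{i\in ALIVE_e} f_i\ge n_e$ for every edge $e$. Its cost is $\sum_{i\in REQ}\min\{f_i,1\}p_i$. The optimal fractional cost is the minimum of $\sum_i f^*_i p_i$ over $f^*_i\in[0,1]$ with $\sum_{i\in REQ_e} f^*_i\ge |REQ_e|-c_e$ for all $e$ (over the whole sequence). An algorithm is $\beta$-competitive if its cost is at most $\beta$ times the optimal cost. *)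

(* Defs.v *)
From HB Require Import structures.
From mathcomp Require Import all_boot all_order all_algebra.
From mathcomp Require Import all_classical all_reals all_analysis.

Set Implicit Arguments.
Unset Strict Implicit.
Unset Printing Implicit Defensive.

Import Order.TTheory GRing.Theory Num.Theory.

Local Open Scope ring_scope.

(* The vertices of the path are [origin :: route]; trivial (edgeless) paths are
   allowed, and never belong to any REQ_e. *)
Record request (V : finType) (E : {set V * V}) (R : realType) := Request {
  origin : V;
  route : seq V;
  price : R;
  route_path : path [rel x y | (x, y) \in E] origin route;
  route_simple : uniq (origin :: route);
  price_gt0 : 0 < price
}.

Definition request_edges (V : finType) (E : {set V * V}) (R : realType)
    (r : request E R) : seq (V * V) :=
  zip (origin r :: route r) (route r).

Definition max_cap (V : finType) (E : {set V * V}) (cap : V * V -> nat) : nat :=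
  \max_(e in E) cap e.

(* In this section [s] is the sequence of requests that have arrived so far,
   and requests are named by their position in [s]. *)
Section Arrived.
Variables (V : finType) (E : {set V * V}) (cap : V * V -> nat) (R : realType).
Variable s : seq (request E R).

Definition req (i : 'I_(size s)) : request E R := tnth (in_tuple s) i.

Definition REQ_edge (e : V * V) : {set 'I_(size s)} :=
  [set i | e \in request_edges (req i)]%SET.

Definition REQ : {set 'I_(size s)} := (\bigcup_(e in E) REQ_edge e)%SET.

Definition ALIVE (f : 'I_(size s) -> R) (e : V * V) : {set 'I_(size s)} :=
  [set i in REQ_edge e | f i < 1]%SET.

Definition excess (f : 'I_(size s) -> R) (e : V * V) : R :=
  #|ALIVE f e|%:R - (cap e)%:R.

Definition covers (f : 'I_(size s) -> R) : Prop :=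
  forall e, e \in E -> excess f e <= \sum_(i in ALIVE f e) f i.

Definition cost (f : 'I_(size s) -> R) : R :=
  \sum_(i in REQ) Num.min (f i) 1 * price (req i).

Definition fractional_solution (g : 'I_(size s) -> R) : Prop :=
  (forall i, 0 <= g i <= 1) /\
  (forall e, e \in E ->
     #|REQ_edge e|%:R - (cap e)%:R <= \sum_(i in REQ_edge e) g i).

Definition solution_cost (g : 'I_(size s) -> R) : R :=
  \sum_i g i * price (req i).

(* The infimum is a minimum: the feasible set is a compact polytope, nonempty
   since it contains the constant function 1. *)
Definition opt : R :=
  inf [set solution_cost g | g in fractional_solution]%classic.

End Arrived.

(* [A s i] is the weight of the request at position [i] once exactly the
   requests of [s] have arrived and been processed; it is a function of [s]
   only, so it cannot depend on later requests. Values at [i >= size s] are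
   irrelevant. *)
Definition algorithm (V : finType) (E : {set V * V}) (R : realType) : Type :=
  seq (request E R) -> nat -> R.

Definition weights (V : finType) (E : {set V * V}) (R : realType)
    (A : algorithm E R) (s : seq (request E R)) : 'I_(size s) -> R :=
  fun i => A s i.

Definition online_fractional (V : finType) (E : {set V * V})
    (cap : V * V -> nat) (R : realType) (A : algorithm E R) : Prop :=
  [/\ forall s (i : 'I_(size s)), 0 <= A s i,
      forall s r (i : 'I_(size s)), A s i <= A (rcons s r) i
    & forall s, covers cap (weights A (s := s))].

(* Competitiveness on the request sequences satisfying [K]. *)
Definition competitive_on (V : finType) (E : {set V * V})
    (cap : V * V -> nat) (R : realType)
    (K : seq (request E R) -> Prop) (beta : R) (A : algorithm E R) : Prop :=
  forall s, K s -> cost (weights A (s := s)) <= beta * opt cap s.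

Definition unit_prices (V : finType) (E : {set V * V}) (R : realType)
    (s : seq (request E R)) : Prop :=
  forall i : 'I_(size s), price (req i) = 1.

(* Main.v *)
(* Let D = c + 1. While some edge e is violated, every alive request i on e gets
   f_i += eps * (f_i + 1/D) / p_i with a small eps. Since n_e >= 1 and
   |ALIVE_e| = n_e + c_e <= n_e * D, the total price of the weights grows by
   eps * (sum f_i + |ALIVE_e| / D) <= 2 * eps * n_e. For a fractional solution g,
   the potential sum_i g_i p_i ln (1 + D f_i) grows by at least
   eps / 2 * sum_{ALIVE_e} g_i >= eps / 2 * n_e, because the factor
   1 + D f_i is multiplied by exactly 1 + eps / p_i. Weights never exceed 3, so
   the price is at most 4 ln (1 + 3 D) times that of g. No guess of the optimum
   is needed, and the O(log c) bound holds for arbitrary prices; the O(log (mc))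
   bound follows from it. *)

Require Import Defs.
From HB Require Import structures.
From mathcomp Require Import all_boot all_order all_algebra.
From mathcomp Require Import all_classical all_reals all_analysis.
From mathcomp Require Import ring lra.

Set Implicit Arguments.
Unset Strict Implicit.
Unset Printing Implicit Defensive.

Import Order.TTheory GRing.Theory Num.Theory.

Local Open Scope ring_scope.

(** Taking [y = 1 / (1 + x) - 1] in [ln (1 + y) <= y] gives [ln (1 + x) >= x / (1 + x)], and
    [1 + x <= 2]. *)
Lemma ln1D_ge_half (R : realType) (x : R) : 0 <= x <= 1 -> x / 2 <= ln (1 + x).
Proof.
move=> /andP[x0 x1]; have y0 : 0 < 1 + x by lra.
have := le_ln1Dx (_ : -1 < (1 + x)^-1 - 1); rewrite addrCA subrr addr0 lnV //.
have yV : (1 + x) * (1 + x)^-1 = 1 by rewrite mulfV// gt_eqF.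
have yV0 : 0 < (1 + x)^-1 by rewrite invr_gt0.
have H : -1 < (1 + x)^-1 - 1 by lra.
move=> /(_ H); nra.
Qed.

Lemma sum_ord_recr_cast (R : nmodType) (m n : nat) (e : n.+1 = m) (F : 'I_m -> R) :
  \sum_i F i = \sum_(i < n) F (cast_ord e (widen_ord (leqnSn n) i))
               + F (cast_ord e ord_max).
Proof.
by case: _ / e F => F; rewrite big_ord_recr/=; congr (_ + _);
  [apply: eq_bigr => i _|]; congr F; apply: val_inj.
Qed.

(** A successor function picked by choice and iterated along the arrivals makes the output depend on
    the prefix alone, which is what being online means. *)
Lemma online_choice (T U : Type) (x : U) (P : seq T -> (nat -> U) -> Prop)
    (le : rel U) :
  P [::] (fun=> x) ->
  (forall s r f, P s f -> exists2 f', P (rcons s r) f' &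
     forall i, (i < size s)%N -> le (f i) (f' i)) ->
  exists A : seq T -> nat -> U, (forall s, P s (A s)) /\
    forall s r i, (i < size s)%N -> le (A s i) (A (rcons s r) i).
Proof.
move=> P0 PS.
have /choice[next nextP] (a : seq T * T * (nat -> U)) : exists f', P a.1.1 a.2 ->
    P (rcons a.1.1 a.1.2) f' /\ forall i, (i < size a.1.1)%N -> le (a.2 i) (f' i).
  case: a => -[s r] f /=; have [/PS-/(_ r)[f' Pf' lef']|nP] := pselect (P s f).
    by exists f'.
  by exists f.
(* Arrivals are appended at the end, so the recursion runs on the reversed sequence, whose head is
   the latest one. *)
pose run := fix run t := if t is r :: t' then next (rev t', r, run t') else fun=> x.
have runP t : P (rev t) (run t).
  elim: t => //= r t IHt; rewrite rev_cons.
  by have [] := nextP (rev t, r, run t) IHt.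
have runrP s : P s (run (rev s)) by rewrite -{1}(revK s).
exists (run \o rev); split=> [//|s r i] /=; rewrite rev_rcons /= revK.
by have [_] := nextP (s, r, run (rev s)) (runrP s); apply.
Qed.

(** * Augmenting weights under a logarithmic potential *)

Section Augmentation.
Variables (V : finType) (E : {set V * V}) (cap : V * V -> nat) (R : realType).
Implicit Types (s : seq (request E R)) (e : V * V).

Lemma price_lower_bound s :
  exists2 eps : R, 0 < eps & forall i : 'I_(size s), eps <= price (req i).
Proof.
exists (\big[Num.min/1]_(i < size s) price (req i)).
  by apply: lt_bigmin => // i _; apply: price_gt0.
by move=> i; apply: bigmin_le_cond.
Qed.

(** Requests on [e] outside [A] absorb at most 1 each because [g <= 1]; the rest of the demand falls
    on [A]. *)
Lemma alive_demand s (g : 'I_(size s) -> R) e (A : {set 'I_(size s)}) :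
  fractional_solution cap g -> e \in E -> A \subset REQ_edge s e ->
  #|A|%:R - (cap e)%:R <= \sum_(i in A) g i.
Proof.
move=> [g01 gE] eE /finset.setIidPr AE; move/gE: eE.
rewrite -[#|A|%:R]sumr_const -[#|REQ_edge _ _|%:R]sumr_const.
rewrite (big_setID A)/= AE [X in _ <= X](big_setID A)/= AE.
have : \sum_(i in REQ_edge s e :\: A) g i <= \sum_(i in REQ_edge s e :\: A) 1.
  by apply: ler_sum => i _; have /andP[] := g01 i.
lra.
Qed.

Variable D : R.
Hypotheses (D_ge1 : 1 <= D) (cap_ltD : forall e, e \in E -> (cap e).+1%:R <= D).

(* The bound 3 leaves room for the overshoot of a last raise from below 1. *)
Definition charged s (f : 'I_(size s) -> R) : Prop :=
  (forall i, 0 <= f i <= 3) /\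
  forall g, fractional_solution cap g ->
    \sum_i f i * price (req i)
      <= 4 * \sum_i g i * price (req i) * ln (1 + D * f i).

Definition raise s (A : {set 'I_(size s)}) (eps : R) (f : 'I_(size s) -> R) i : R :=
  if i \in A then f i + eps * (f i + D^-1) / price (req i) else f i.

Let D_gt0 : 0 < D. Proof. exact: lt_le_trans D_ge1. Qed.

Lemma charged_raise s (f : 'I_(size s) -> R) e (eps : R) : 0 < eps ->
  (forall i : 'I_(size s), eps <= price (req i)) ->
  e \in E -> \sum_(i in ALIVE f e) f i < excess cap f e ->
  charged f -> charged (raise (ALIVE f e) eps f).
Proof.
move=> eps0 epsp eE viol [f03 fch].
have d0 : 0 < D^-1 by rewrite invr_gt0.
have d1 : D^-1 <= 1 by rewrite invf_le1.
have r01 (i : 'I_(size s)) : 0 < eps / price (req i) <= 1.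
  by rewrite divr_gt0 ?price_gt0 //= ler_pdivrMr ?price_gt0 // mul1r.
split=> [i|g gfrac].
  (* For an alive request [f i < 1], [D^-1 <= 1] and [eps / price (req i) <= 1], so the increment is
     below 2. *)
  rewrite /raise; case: ifP => [|_]; last exact: f03.
  rewrite inE => /andP[_ fi1].
  have /andP[f0 _] := f03 i; have /andP[r0 r1] := r01 i.
  have fd0 : 0 <= f i + D^-1 by rewrite addr_ge0 // ltW.
  have le_fd := ler_piMl fd0 r1; have ge0 := mulr_ge0 (ltW r0) fd0.
  by rewrite mulrAC; apply/andP; split; lra.
have g0 i : 0 <= g i by have [/(_ i)/andP[]] := gfrac.
pose A := ALIVE f e.
have AE : A \subset REQ_edge s e by apply/fintype.subsetP => i; rewrite inE => /andP[].
have demand := alive_demand gfrac eE AE.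
(* The excess beats a sum of nonnegative weights, so it is positive; being an integer, it is at
   least 1. *)
have excess1 : (cap e < #|A|)%N.
  rewrite -(ltr_nat R) -subr_gt0; apply: le_lt_trans viol.
  by apply: sumr_ge0 => i _; have /andP[] := f03 i.
have dA : D^-1 * #|A|%:R <= #|A|%:R - (cap e)%:R.
  rewrite mulrC ler_pdivrMr //.
  have le1 : 1 <= #|A|%:R - (cap e)%:R :> R.
    by rewrite -natrB 1?ltnW // ler1n subn_gt0.
  have := cap_ltD eE; rewrite -natr1 => leD.
  have := ler_wpM2r (ler0n R (cap e)) le1.
  have : 0 <= #|A|%:R - (cap e)%:R :> R by apply: le_trans le1.
  by move=> /ler_wpM2l-/(_ _ _ leD); lra.
have -> : \sum_i raise A eps f i * price (req i)
    = \sum_i f i * price (req i) + eps * \sum_(i in A) (f i + D^-1).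
  rewrite mulr_sumr [X in _ = _ + X]big_mkcond -big_split /=; apply: eq_bigr => i _.
  rewrite /raise; case: ifP => _; rewrite ?addr0 // mulrDl divfK //.
  by rewrite gt_eqF ?price_gt0.
have step : \sum_i g i * price (req i) * ln (1 + D * f i)
      + eps / 2 * \sum_(i in A) g i
    <= \sum_i g i * price (req i) * ln (1 + D * raise A eps f i).
  rewrite mulr_sumr [X in _ + X]big_mkcond -big_split /=; apply: ler_sum => i _.
  rewrite /raise; case: ifP => _; rewrite ?addr0 //.
  have /andP[f0 _] := f03 i; have /andP[r0 r1] := r01 i.
  have -> : 1 + D * (f i + eps * (f i + D^-1) / price (req i))
     = (1 + D * f i) * (1 + eps / price (req i)).
    by field; rewrite !gt_eqF ?price_gt0.
  rewrite lnM ?posrE; last 2 first.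
  - by rewrite ltr_wpDr // mulr_ge0 // ltW.
  - by rewrite ltr_wpDr // ltW.
  rewrite mulrDr lerD2l.
  have -> : eps / 2 * g i = g i * price (req i) * (eps / price (req i) / 2).
    by field; rewrite gt_eqF ?price_gt0.
  apply: ler_wpM2l; first by rewrite mulr_ge0 // ltW // price_gt0.
  by apply: ln1D_ge_half; rewrite ltW.
have fgain : \sum_(i in A) (f i + D^-1) <= 2 * \sum_(i in A) g i.
  rewrite big_split /= sumr_const -[_ *+ _]mulr_natr.
  by move: viol; rewrite /excess -/A; lra.
(* With sums over [A], the total price grows by at most [2 * eps * \sum g] and the potential by at
   least [eps / 2 * \sum g]; their ratio is the 4 in [charged]. *)
have := fch g gfrac; nra.
Qed.

(** * Arrival of one more request *)

Definition earlier s r (i : 'I_(size s)) : 'I_(size (rcons s r)) :=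
  cast_ord (esym (size_rcons s r)) (widen_ord (leqnSn (size s)) i).

Definition latest s (r : request E R) : 'I_(size (rcons s r)) :=
  cast_ord (esym (size_rcons s r)) ord_max.

Lemma req_earlier s r (i : 'I_(size s)) : req (earlier r i) = req i.
Proof. by rewrite /req !(tnth_nth r) /= nth_rcons ltn_ord. Qed.

(** The earlier requests through [e] embed into all requests through [e], so [alive_demand] applies
    to their image. *)
Lemma fractional_solution_earlier s r (g : 'I_(size (rcons s r)) -> R) :
  fractional_solution cap g -> fractional_solution cap (g \o @earlier s r).
Proof.
move=> gfrac; split=> [i|e eE]; first by have [g01 _] := gfrac; apply: g01.
have earlier_inj : injective (@earlier s r).
  by move=> i j /(congr1 val) /= ij; apply: val_inj.
have sub : earlier r @: REQ_edge s e \subset REQ_edge (rcons s r) e.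
  apply/fintype.subsetP => _ /imsetP[i ie ->].
  by move: ie; rewrite !inE req_earlier.
have := alive_demand gfrac eE sub.
by rewrite card_imset // big_imset //=; apply: in2W.
Qed.

(** A newcomer of weight 0 adds nothing to either side, since [ln 1 = 0]. *)
Lemma charged_rcons s r (f : 'I_(size s) -> R) (f' : 'I_(size (rcons s r)) -> R) :
  (forall i, f' (earlier r i) = f i) -> f' (latest s r) = 0 ->
  charged f -> charged f'.
Proof.
move=> f'f f'0 [f03 fch]; split=> [i|g gfrac].
  case: (ltnP i (size s)) => [lti|gei].
    by have := f03 (Ordinal lti); rewrite -f'f; congr (0 <= f' _ <= 3); apply: val_inj.
  suff -> : i = latest s r by rewrite f'0 lexx ler0n.
  apply/val_inj/eqP; rewrite eqn_leq gei andbT.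
  by have := ltn_ord i; rewrite [X in (_ < X)%N]size_rcons.
rewrite !(sum_ord_recr_cast (esym (size_rcons s r))) -/(latest s r) f'0.
rewrite mulr0 addr0 ln1 mulr0 mul0r !addr0.
have := fch _ (fractional_solution_earlier gfrac).
rewrite [X in X <= _ -> _](_ : _ = \sum_i f' (earlier r i) * price (req (earlier r i))).
  rewrite [X in _ <= 4 * X -> _](_ : _ = \sum_i g (earlier r i) *
    price (req (earlier r i)) * ln (1 + D * f' (earlier r i))) //.
  by apply: eq_bigr => i _; rewrite f'f req_earlier.
by apply: eq_bigr => i _; rewrite f'f req_earlier.
Qed.

Lemma covers_augment s (f : 'I_(size s) -> R) : charged f ->
  exists f' : 'I_(size s) -> R,
    [/\ charged f', covers cap f' & forall i, f i <= f' i].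
Proof.
have [eps eps0 epsp] := price_lower_bound s.
have eta0 : 0 < eps * D^-1 by rewrite mulr_gt0 // invr_gt0.
(* Each raise adds at least [eps / D] to the total price, which stays
   bounded because no weight exceeds 3. *)
pose B : R := \sum_(i < size s) 3 * price (req i).
have [k] : exists k : nat, B - \sum_i f i * price (req i) < (eps * D^-1) *+ k.
  exists (Num.truncn ((B - \sum_i f i * price (req i)) / (eps * D^-1))).+1.
  by rewrite -[_ *+ _]mulr_natl -ltr_pdivrMr // truncnS_gt.
(* [k] bounds the raises still possible; [k = 0] would put the total price above [B]. *)
elim: k f => [|k IHk] f ltk fch.
  have : \sum_i f i * price (req i) <= B.
    apply: ler_sum => i _; apply: ler_wpM2r; first by rewrite ltW // price_gt0.
    by have [/(_ i)/andP[]] := fch.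
  by move: ltk; rewrite mulr0n; lra.
have [cov|/existsNP[e /not_implyP[eE /negP]]] := pselect (covers cap f).
  by exists f; split.
rewrite -ltNge => viol.
have f'ch := charged_raise eps0 epsp eE viol fch.
have f0 i : 0 <= f i by have [/(_ i)/andP[]] := fch.
have le_raise i : f i <= raise (ALIVE f e) eps f i.
  rewrite /raise; case: ifP => // _; rewrite ler_wpDr // divr_ge0 //.
    by rewrite mulr_ge0 ?addr_ge0 // ?invr_ge0 ltW.
  by rewrite ltW // price_gt0.
(* With no alive request the excess is [- cap e], at most the empty sum, so [e] would not be
   violated. The gain of [j] alone already reaches [eps / D]. *)
have [j jA] : exists j, j \in ALIVE f e.
  apply/existsP; rewrite -/(_ != _); apply: contraTN viol => /pred0P A0.
  rewrite /excess (eq_card0 A0) big_pred0 // -leNgt.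
  by rewrite sub0r oppr_le0.
have [|f'' [f''ch cov lef'']] := IHk _ _ f'ch; last first.
  by exists f''; split=> // i; apply: le_trans (le_raise i) (lef'' i).
apply: (@le_lt_trans _ _
    (B - (\sum_i f i * price (req i) + eps * D^-1))); last first.
  by move: ltk; rewrite mulrS; lra.
rewrite lerD2l lerN2 (bigD1 j) //= [X in _ <= X](bigD1 j) //= addrAC.
apply: lerD; last first.
  by apply: ler_sum => i _; apply: ler_wpM2r; rewrite // ltW // price_gt0.
rewrite /raise jA mulrDl divfK ?gt_eqF ?price_gt0 // lerD2l.
by rewrite ler_pM2l // lerDr.
Qed.

Lemma charged_cost s (f : 'I_(size s) -> R) (K : R) :
  0 < K -> 4 * ln (1 + 3 * D) <= K -> charged f -> cost f <= K * opt cap s.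
Proof.
(* After division by [K], the claim is that the cost bounds every solution cost from below; the
   constant 1 shows that the infimum is over a nonempty set. *)
move=> K0 leK [f03 fch]; rewrite mulrC -ler_pdivrMr //; apply: lb_le_inf.
  exists (solution_cost (fun _ : 'I_(size s) => 1)), (fun=> 1) => //.
  split=> [i|e eE]; first by rewrite ler01 lexx.
  by rewrite sumr_const gerDl oppr_le0.
move=> _ [g gfrac <-]; rewrite ler_pdivrMr //.
have gp0 i : 0 <= g i * price (req i).
  have [/(_ i)/andP[g0 _] _] := gfrac.
  by rewrite mulr_ge0 // ltW // price_gt0.
have le_cost : cost f <= \sum_i f i * price (req i).
  rewrite /cost big_mkcond; apply: ler_sum => i _.
  have p0 := ltW (price_gt0 (req i)); have /andP[f0 _] := f03 i.
  case: ifP => _; last exact: mulr_ge0.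
  by rewrite ler_wpM2r // ge_min lexx.
apply: le_trans le_cost (le_trans (fch _ gfrac) _).
apply: le_trans (ler_wpM2l _ leK); last exact: sumr_ge0.
rewrite mulrCA ler_pM2l // /solution_cost mulr_suml ler_sum // => i _.
have /andP[f0 f3] := f03 i; rewrite ler_wpM2l // ler_ln ?posrE.
- by rewrite lerD2l mulrC ler_pM2r.
- by rewrite ltr_wpDr // mulr_ge0 // ltW.
- by rewrite ltr_wpDr // mulr_ge0 // ltW.
Qed.

(** [K] is quantified after [A], so a single algorithm serves both competitive ratios. *)
Lemma exists_online :
  exists2 A : algorithm E R, online_fractional cap A &
    forall K, 0 < K -> 4 * ln (1 + 3 * D) <= K ->
      competitive_on cap (fun _ => True) K A.
Proof.
pose P s (f : nat -> R) :=
  charged (fun i : 'I_(size s) => f i) /\ covers cap (fun i : 'I_(size s) => f i).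
have [||A [AP leA]] := @online_choice _ _ 0 P <=%R; last first.
- exists A => [|K K0 leK s _]; last first.
    by apply: charged_cost => //; have [] := AP s.
  split=> [s i|s r i|s]; last by have [] := AP s.
    by have [[/(_ i)/andP[]]] := AP s.
  exact: leA.
- move=> s r f [fch _].
  pose f0 (i : 'I_(size (rcons s r))) := if (i < size s)%N then f i else 0.
  have f0ch : charged f0.
    by apply: charged_rcons fch => [i|]; rewrite /f0 /= ?ltn_ord ?ltnn.
  have [f' [f'ch cov lef']] := covers_augment f0ch.
  (* Algorithms assign weights to all naturals: [insub] extends [f'] by 0 beyond the sequence. *)
  exists (fun k => oapp f' 0 (insub k)); rewrite /P.
    suff -> : (fun i : 'I_(size (rcons s r)) => oapp f' 0 (insub (val i))) = f'.
      by split.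
    by apply/funext => i; rewrite valK.
  move=> i lti; have lti' : (i < size (rcons s r))%N by rewrite size_rcons ltnW.
  by rewrite insubT /=; have := lef' (Ordinal lti'); rewrite /f0 /= lti.
- split; last first.
    move=> e _; rewrite /excess (_ : ALIVE _ e = finset.set0).
      by rewrite cards0 big_set0 sub0r oppr_le0.
    by apply/finset.setP => -[].
  by split=> [[]//|g _]; rewrite !big_ord0 mulr0.
Qed.

End Augmentation.

Lemma ln_max_cap_bound (R : realType) (c : nat) :
  4 * ln (1 + 3 * c.+1%:R) <= 28 * (1 + ln c%:R) :> R.
Proof.
(* For [c = 0], the value for an edgeless graph, the convention [ln 0 = 0] leaves 28 on the
   right. *)
case: c => [|c].
  rewrite [ln 0%:R]ln0 // addr0 !mulr1.
  have : ln (1 + 3) <= 3 :> R by apply: le_ln1Dx; lra.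
  by lra.
have c1 : 1 <= c.+1%:R :> R by rewrite ler1n.
have lnc0 : 0 <= ln (c.+1%:R : R) by rewrite ln_ge0.
have ln7 : ln 7 <= 6 :> R.
  have -> : 7 = 1 + 6 :> R by ring.
  by apply: le_ln1Dx; lra.
(* With [n = c.+1], [1 + 3 * (n + 1) <= 7 * n] because [n >= 1]; then [4 * ln 7 <= 24]. *)
suff : ln (1 + 3 * c.+2%:R) <= ln 7 + ln c.+1%:R :> R by lra.
rewrite -lnM ?posrE ?ltr0n // ler_ln ?posrE //.
by rewrite -natr1; lra.
Qed.

Theorem theorem1 (R : realType) :
  exists2 C : R, 0 < C &
    forall (V : finType) (E : {set V * V}) (cap : V * V -> nat),
      (forall e, e \in E -> (0 < cap e)%N) ->
      exists A : algorithm E R,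
        [/\ online_fractional cap A,
            competitive_on cap (fun _ => True)
              (C * (1 + ln (#|E| * max_cap E cap)%:R)) A
          & competitive_on cap (@unit_prices V E R)
              (C * (1 + ln (max_cap E cap)%:R)) A].
Proof.
exists 28 => [//|V E cap _].
have capD e : e \in E -> (cap e).+1%:R <= (max_cap E cap).+1%:R :> R.
  by move=> eE; rewrite ler_nat ltnS; apply: leq_bigmax_cond.
have [|A Aonline Acomp] := exists_online _ capD; first by rewrite ler1n.
have le_c := ln_max_cap_bound R (max_cap E cap).
have ln4 : 0 < ln (1 + 3 * (max_cap E cap).+1%:R) :> R.
  by rewrite ln_gt0 // ltrDl mulr_gt0.
have ln_mono : ln (max_cap E cap)%:R <= ln (#|E| * max_cap E cap)%:R :> R.
  (* The maximum over no edges is 0, so both logarithms then have argument 0. *)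
  have [E0|E_gt0] := posnP #|E|.
    suff -> : max_cap E cap = 0 by rewrite muln0.
    by rewrite /max_cap big_pred0 // => e; rewrite (card0_eq E0).
  have [->|c_gt0] := posnP (max_cap E cap); first by rewrite muln0.
  by rewrite ler_ln ?posrE ?ltr0n ?muln_gt0 ?E_gt0 // ler_nat leq_pmull.
exists A; split=> // [|s _]; last by apply: Acomp => //; lra.
by apply: Acomp; lra.
Qed.
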